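(* Let $m\ge2$ be a fixed integer. For each $n$, let $(k_1,\dots,k_m)\vdash n$ follow the uniform distribution on $\mathcal{P}_n(m)$ or, alternatively, the uniform distribution on $\mathcal{P}_n'(m)$. Then, in either case, as $n\to\infty$, $\frac1n(k_1,\dots,k_m)$ converges weakly to the uniform distribution on the ordered simplex $$\Delta:=\Big\{(x_1,\dots,x_m)\in[0,1]^m:\ x_1>\cdots>x_m\ \text{and}\ \sum_{i=1}^m x_i=1\Big\}.$$
   Context: $\mathcal{P}_n(m)$ is the set of partitions of $n$ with at most $m$ parts and $\mathcal{P}_n'(m)$ is the set of partitions of $n$ with exactly $m$ (positive) parts. A partition with at most $m$ parts is written $(k_1,\dots,k_m)$ with $k_1\ge\cdots\ge k_m\ge0$, $\sum_i k_i=n$ (padded with zeros if necessary). The uniform distribution on $\Delta$ is normalized $(m-1)$-dimensional surface (Lebesgue) measure on $\Delta$ inside the hyperplane $\sum_i x_i=1$. *)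

(* Defs.v *)
From HB Require Import structures.
From mathcomp Require Import all_boot all_order all_algebra.
From mathcomp Require Import all_classical all_reals all_analysis.
From mathcomp Require Import measurable_realfun.

Set Implicit Arguments.
Unset Strict Implicit.
Unset Printing Implicit Defensive.
Import Order.TTheory GRing.Theory Num.Theory.
Import numFieldNormedType.Exports.

Local Open Scope classical_set_scope.
Local Open Scope ring_scope.

Notation borel T := (g_sigma_algebraType [set U : set T | open U]).

Definition weak_cvg (R : realType) (m : nat)
    (P_ : nat -> probability (borel 'rV[R]_m) R)
    (P : probability (borel 'rV[R]_m) R) : Prop :=
  forall f : 'rV[R]_m -> R, continuous f -> bounded_fun f ->
    (\int[P_ n]_x (f x)%:E @[n --> \oo] --> \int[P]_x (f x)%:E)%E.

(* The Dirac mass is only a default value, used by [mnormalize] when [mu A] is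
   [0] (e.g. for [A] empty) or [+oo]. *)
Definition uniform_law d (T : measurableType d) (R : realType)
    (mu : {measure set T -> \bar R}) (A : set T) (mA : measurable A) :
    probability T R :=
  mnormalize (mrestr mu mA) (dirac point).

(* Partitions of [n] with at most [m] parts, padded with zeros to length [m] *)
Definition partitions_at_most (m n : nat) : set (m.-tuple nat) :=
  [set k | sorted geq k /\ sumn k = n].
Arguments partitions_at_most m n : clear implicits.

Definition partitions_exactly (m n : nat) : set (m.-tuple nat) :=
  partitions_at_most m n `&` [set k | all (leq 1) k].
Arguments partitions_exactly m n : clear implicits.

Lemma measurable_tuple_nat (m : nat) (A : set (m.-tuple nat)) : measurable A.
Proof.
have m1 (k : m.-tuple nat) : measurable [set k].
  rewrite (_ : [set k] =
    \bigcap_(i in [set: 'I_m]) ((@tnth _ nat ^~ i) @^-1` [set tnth k i])).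
    apply: fin_bigcap_measurable => // i _.
    by rewrite -[X in measurable X]setTI; exact: measurable_tnth.
  apply/seteqP; split=> [_ -> //|l /= lk].
  by apply: eq_from_tnth => i; exact: lk.
by apply: countable_measurable => //; exact: countableP.
Qed.

Lemma borel_rV_measurable_fun d (T : measurableType d) (R : realType) (m : nat)
    (f : T -> 'rV[R]_m) :
  (forall i, measurable_fun setT (fun t => f t ord0 i)) ->
  measurable_fun setT (f : T -> borel 'rV[R]_m).
Proof.
move=> mf; apply: (@measurability _ _ T (borel 'rV[R]_m) setT f
  [set U : set 'rV[R]_m | open U]) => //.
move=> _ [U oU <-]; rewrite setTI.
pose box (q : m.-tuple (rat * rat)) : set 'rV[R]_m :=
  [set x | forall i, ratr (tnth q i).1 < x ord0 i < ratr (tnth q i).2].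
have mbox q : measurable (f @^-1` box q).
  rewrite (_ : _ @^-1` _ = \bigcap_(i in [set: 'I_m])
    ((fun t => f t ord0 i) @^-1` `]ratr (tnth q i).1, ratr (tnth q i).2[)).
    apply: fin_bigcap_measurable => // i _.
    by rewrite -[X in measurable X]setTI; exact: mf.
  apply/seteqP; split=> [t ft i _|t ft i].
    by rewrite /= in_itv/=; exact: ft.
  by have /(_ I) := ft i; rewrite /= in_itv.
have -> : U = \bigcup_(q in [set q | box q `<=` U]) box q.
  apply/seteqP; split=> [x Ux|x [q]]; last exact.
  have [e /= e0 xeU] := (nbhs_ballP _ _).1 (open_nbhs_nbhs (conj oU Ux)).
  have itv i : exists q : rat * rat,
      x ord0 i - e < ratr q.1 < x ord0 i /\
      x ord0 i < ratr q.2 < x ord0 i + e.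
    have /rat_in_itvoo[p pi] : x ord0 i - e < x ord0 i by rewrite ltrBlDr ltrDl.
    have /rat_in_itvoo[q qi] : x ord0 i < x ord0 i + e by rewrite ltrDl.
    by exists (p, q); move: pi qi; rewrite !in_itv.
  have [g gP] := choice itv.
  exists [tuple g i | i < m] => [|i]; last first.
    by rewrite tnth_mktuple; have [/andP[_ ->] /andP[->]] := gP i.
  move=> y gy; apply: xeU; split=> [//|i j]; rewrite (ord1 i).
  have := gy j; rewrite tnth_mktuple => /andP[gy1 gy2].
  have [/andP[g1 _] /andP[_ g2]] := gP j.
  rewrite /ball/= ltr_distlC; apply/andP; split.
    exact: lt_trans gy1.
  exact: lt_trans g2.
rewrite preimage_bigcup bigcup_mkcond.
by apply: countable_bigcupT_measurable => // q; case: ifP.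
Qed.

Definition rescale (R : realType) (m n : nat) (k : m.-tuple nat) :
    borel 'rV[R]_m :=
  \row_i ((tnth k i)%:R / n%:R).

Section rescale_measurable.
Variables (R : realType) (m n : nat).

Let rescale_measurable : measurable_fun setT (@rescale R m n).
Proof. by move=> _ Y mY; exact: measurable_tuple_nat. Qed.

HB.instance Definition _ := isMeasurableFun.Build _ _ _ _ (@rescale R m n)
  rescale_measurable.
End rescale_measurable.

Definition uniform_partition (R : realType) (m : nat) (A : set (m.-tuple nat)) :
    probability (m.-tuple nat) R :=
  uniform_law counting (measurable_tuple_nat A).

Definition rescaled_partition_law (R : realType) (m n : nat)
    (A : set (m.-tuple nat)) : probability (borel 'rV[R]_m) R :=
  distribution (uniform_partition R A) (@rescale R m n).

Section image_measure.
Context d d' (T1 : measurableType d) (T2 : measurableType d') (R : realType).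
Variables (mu : {measure set T1 -> \bar R}) (f : {mfun T1 >-> T2}).

Definition image_measure : set T2 -> \bar R := pushforward mu f.

Let image_measure0 : image_measure set0 = 0%E.
Proof. exact: measure0. Qed.

Let image_measure_ge0 A : (0 <= image_measure A)%E.
Proof. exact: measure_ge0. Qed.

Let image_measure_sigma_additive : semi_sigma_additive image_measure.
Proof. exact: measure_semi_sigma_additive. Qed.

HB.instance Definition _ := isMeasure.Build _ _ _ image_measure
  image_measure0 image_measure_ge0 image_measure_sigma_additive.
End image_measure.

Section power_measure.
Context d (T : measurableType d) (R : realType).
Variable mu : {sigma_finite_measure set T -> \bar R}.

Definition tuple_cons n (x : T * n.-tuple T) : n.+1.-tuple T :=
  [tuple of x.1 :: x.2].

Let tuple_cons_measurable n : measurable_fun setT (@tuple_cons n).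
Proof. exact: measurable_cons. Qed.

HB.instance Definition _ n := isMeasurableFun.Build _ _ _ _ (@tuple_cons n)
  (@tuple_cons_measurable n).

Section step.
Variables (n : nat) (nu : {sigma_finite_measure set (n.-tuple T) -> \bar R}).

Definition cons_measure : set (n.+1.-tuple T) -> \bar R :=
  image_measure (mu \x nu)%E (@tuple_cons n).

HB.instance Definition _ := Measure.on cons_measure.

Let cons_measure_sigma_finite : sigma_finite setT cons_measure.
Proof.
have /sigma_finiteP[F [FT ndF Foo]] := sigma_finiteT mu.
have /sigma_finiteP[G [GT ndG Goo]] := sigma_finiteT nu.
pose g (y : n.+1.-tuple T) : T * n.-tuple T := (thead y, [tuple of behead y]).
have mg : measurable_fun setT g.
  apply: measurable_fun_pair; last exact: measurable_behead.
  exact: measurable_tnth.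
exists (fun i => g @^-1` (F i `*` G i)).
  rewrite -preimage_bigcup (_ : \bigcup_i _ = setT) ?preimage_setT//.
  apply/seteqP; split=> // -[x y] _.
  have [i _ Fx] : (\bigcup_i F i) x by rewrite -FT.
  have [j _ Gy] : (\bigcup_i G i) y by rewrite -GT.
  exists (maxn i j) => //; split=> /=.
    by move: x Fx; exact/subsetPset/ndF/leq_maxl.
  by move: y Gy; exact/subsetPset/ndG/leq_maxr.
move=> i; have [mF Flty] := Foo i; have [mG Glty] := Goo i; split.
  by rewrite -[X in measurable X]setTI; apply: mg => //; exact: measurableX.
rewrite /cons_measure /image_measure /pushforward -comp_preimage.
rewrite (_ : g \o _ = id); last first.
  by apply/funext => -[x y]; congr pair; apply: val_inj.
rewrite preimage_id [ltLHS](product_measure1E mu nu mF mG).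
by rewrite lte_mul_pinfty// ge0_fin_numE.
Qed.

HB.instance Definition _ := Measure_isSigmaFinite.Build _ _ _ cons_measure
  cons_measure_sigma_finite.
End step.

Fixpoint power_measure n : {sigma_finite_measure set (n.-tuple T) -> \bar R} :=
  if n is n'.+1 then cons_measure (power_measure n') else dirac [tuple].
End power_measure.

Definition lebesgue_tuple (R : realType) (n : nat) :
    {measure set (n.-tuple (measurableTypeR R)) -> \bar R} :=
  power_measure (@lebesgue_measure R) n.

(* The hyperplane [\sum_i x_i = 1] of R^m is the graph of
   [y |-> 1 - \sum_j y_j] over the first [m - 1] coordinates. *)
Definition hyperplane_point (R : realType) (m : nat)
    (y : m.-1.-tuple (measurableTypeR R)) : borel 'rV[R]_m :=
  \row_(i < m) nth (1 - \sum_(j < m.-1) tnth y j) y i.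

Lemma hyperplane_point_measurable (R : realType) (m : nat) :
  measurable_fun setT (@hyperplane_point R m).
Proof.
apply: borel_rV_measurable_fun => i.
have [im|im] := ltnP i m.-1.
  rewrite (_ : (fun _ => _) = @tnth _ R ^~ (Ordinal im)).
    exact: measurable_tnth.
  apply/funext => y; rewrite mxE (tnth_nth (1 - \sum_(j < m.-1) tnth y j)).
  by [].
rewrite (_ : (fun _ => _) = fun y => 1 - \sum_(j < m.-1) tnth y j).
  apply: measurable_funB => //; apply: measurable_sum => j.
  exact: measurable_tnth.
by apply/funext => y; rewrite mxE nth_default ?size_tuple.
Qed.

HB.instance Definition _ (R : realType) (m : nat) :=
  isMeasurableFun.Build _ _ _ _ (@hyperplane_point R m)
    (@hyperplane_point_measurable R m).

(* Surface measure of this graph: the area element of the graph of [g] is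
   [sqrt (1 + |grad g|^2)], and here [grad g = (-1, ..., -1)]. *)
Definition hyperplane_surface (R : realType) (m : nat) :
    {measure set (borel 'rV[R]_m) -> \bar R} :=
  mscale (NngNum (sqrtr_ge0 (1 + \sum_(j < m.-1) (-1) ^+ 2)))
    (image_measure (lebesgue_tuple R m.-1) (@hyperplane_point R m)).

Definition ordered_simplex (R : realType) (m : nat) : set (borel 'rV[R]_m) :=
  [set x : 'rV[R]_m | [/\ forall i, 0 <= x ord0 i <= 1,
    forall i j : 'I_m, (i < j)%N -> x ord0 j < x ord0 i &
    \sum_i x ord0 i = 1]].
Arguments ordered_simplex R m : clear implicits.

Lemma ordered_simplex_measurable (R : realType) (m : nat) :
  measurable (ordered_simplex R m).
Proof.
pose c (i : 'I_m) (x : borel 'rV[R]_m) : R := (x : 'rV[R]_m) ord0 i.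
have mc i : measurable_fun setT (c i).
  apply: (measurability _ (RGenOpens.measurableE R)).
  move=> _ [_ [a [b ->]] <-]; rewrite setTI; apply: sub_sigma_algebra.
  by apply: open_comp => [x _|]; [exact: coord_continuous|exact: interval_open].
have mB (p : borel 'rV[R]_m -> bool) :
    measurable_fun setT p -> measurable [set x | p x].
  move=> mp; have := mp measurableT [set true] I.
  by rewrite setTI; congr measurable; apply/seteqP; split.
rewrite (_ : ordered_simplex R m =
  (\bigcap_(i in [set: 'I_m]) [set x | (0 <= c i x) && (c i x <= 1)]) `&`
  (\bigcap_(i in [set: 'I_m]) \bigcap_(j in [set j : 'I_m | (i < j)%N])
     [set x | c j x < c i x]) `&`
  [set x | \sum_i c i x == 1]).
  apply: measurableI; first apply: measurableI.
  - apply: fin_bigcap_measurable => // i _; apply: mB.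
    by apply: measurable_and; exact: measurable_fun_ler.
  - apply: fin_bigcap_measurable => // i _.
    apply: fin_bigcap_measurable => // j _; apply: mB.
    exact: measurable_fun_ltr.
  - by apply: mB; apply: measurable_fun_eqr => //; exact: measurable_sum.
apply/seteqP; split=> [x [x01 xdec /eqP x1]|x [[x01 xdec] /eqP x1]].
  by split=> //; split=> [i _|i _ j ij]; [exact: x01|exact: xdec].
by split=> // [i|i j ij]; [exact: x01|exact: xdec].
Qed.

Definition uniform_ordered_simplex (R : realType) (m : nat) :
    probability (borel 'rV[R]_m) R :=
  uniform_law (hyperplane_surface R m) (@ordered_simplex_measurable R m).

(* Main.v *)
Require Import Defs.
From mathcomp Require Import all_boot all_order all_algebra.
From mathcomp Require Import all_classical all_reals all_analysis.
From mathcomp Require Import measurable_realfun ring lra.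

Set Implicit Arguments.
Unset Strict Implicit.
Unset Printing Implicit Defensive.
Import Order.TTheory GRing.Theory Num.Theory.
Import numFieldNormedType.Exports.

Local Open Scope classical_set_scope.
Local Open Scope ring_scope.

(** Put [d = m - 1].  A partition of [n] into [m] parts is determined by its
    first [d] parts, so rounding down turns a point [y] with nonnegative
    coordinates into a candidate partition: the parts are the integer parts of
    [n * y_j], and the last part is what is missing to [n]
    ([floor_partition]).  The points rounded to a given partition form a cube
    of side [1 / n].  Hence the uniform distribution on any set [V] of
    partitions of [n] is the image under [floor_partition n] of the uniform
    distribution on the union of the cubes of [V] ([lebesgue_floor_cell],
    [rescaled_partition_law_mass]).  In the same way the uniform distribution
    on the ordered simplex is the image of the uniform distribution on the set
    [simplex_chart] of R^d: the surface measure is a constant multiple of the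
    Lebesgue measure of the projection on the first [d] coordinates
    ([uniform_ordered_simplex_mass]).

    Every law in the statement is thus carried by the same measured space R^d,
    and it is enough to compare regions and maps there.  Rounding moves each
    rescaled coordinate by at most [m / n] ([floor_partition_close]).  So, off
    the hyperplanes where two coordinates agree or the last one vanishes, [y]
    belongs to the union of the cubes for all large [n] if it is in the chart,
    and for no large [n] otherwise ([near_floor_cell_chart]); the rounded
    point tends to the point itself.  The excluded hyperplanes are null
    ([affine_hyperplane_null]), all the regions lie in one bounded cube, and
    dominated convergence gives the limit of both the integral of the test
    function and the total mass ([weak_cvg_image_of_uniform]); the limit mass
    is positive ([simplex_chart_gt0]).

    The only property of the set of partitions that matters is that it lies
    between the partitions with exactly [m] parts and those with at most [m]
    parts: a point of the chart with distinct nonzero coordinates is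
    eventually rounded to a partition with [m] positive, strictly decreasing
    parts, whereas a point rounded infinitely often to a partition has
    nonnegative and weakly decreasing coordinates. *)

(** * Boxes and hyperplanes for power measures *)

Section power_measure_theory.
Context d (T : measurableType d) (R : realType).
Variable mu : {sigma_finite_measure set T -> \bar R}.

(** The family of sides is indexed by all natural numbers, so that removing the
    first coordinate amounts to precomposing it with the successor. *)
Definition box n (I : nat -> set T) : set (n.-tuple T) :=
  [set y | forall i : 'I_n, I i (tnth y i)].

Lemma measurable_box n (I : nat -> set T) :
  (forall i, measurable (I i)) -> measurable (@box n I).
Proof.
move=> mI; rewrite (_ : box _ =
    \bigcap_(i in [set: 'I_n]) ((@tnth n T ^~ i) @^-1` I i)).
  apply: fin_bigcap_measurable => // i _.
  by rewrite -[X in measurable X]setTI; exact: measurable_tnth.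
by apply/seteqP; split=> [y yI i _|y yI i]; exact: yI.
Qed.

Lemma power_measureS n (A : set (n.+1.-tuple T)) :
  power_measure mu n.+1 A = 
    (mu \x power_measure mu n)%E (@tuple_cons d T n @^-1` A).
Proof. by []. Qed.

Lemma tnth_tuple_cons0 n (x : T * n.-tuple T) :
  tnth (tuple_cons x) ord0 = x.1.
Proof. by rewrite (tnth_nth x.1). Qed.

Lemma tnth_tuple_consS n (x : T * n.-tuple T) (i : 'I_n) :
  tnth (tuple_cons x) (lift ord0 i) = tnth x.2 i.
Proof. by rewrite (tnth_nth x.1) (tnth_nth x.1 x.2). Qed.

Lemma power_measure_box n (I : nat -> set T) : (forall i, measurable (I i)) ->
  power_measure mu n (@box n I) = (\prod_(i < n) mu (I i))%E.
Proof.
elim: n I => [|n IH] I mI.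
  rewrite big_ord0 /= diracE mem_set// => -[k k0].
  by have := k0; rewrite ltn0.
rewrite power_measureS big_ord_recl (_ : _ @^-1` _ = I 0%N `*` @box n (I \o S)).
  rewrite [LHS]product_measure1E//; last first.
    by apply: measurable_box => i; exact: mI.
  by rewrite IH => [//|i]; exact: mI.
apply/seteqP; split=> [x xI|x [x0 xS] i].
  split; first by have := xI ord0; rewrite tnth_tuple_cons0.
  by move=> i; have := xI (lift ord0 i); rewrite tnth_tuple_consS.
case: (unliftP ord0 i) => [j ->|->]; last by rewrite tnth_tuple_cons0.
by rewrite tnth_tuple_consS; exact: xS.
Qed.
End power_measure_theory.

Section lebesgue_tuple_theory.
Variable R : realType.

Lemma lebesgue_tuple_cube n (a : nat -> R) (s : R) : 0 <= s ->
  lebesgue_tuple R n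
    (@box _ (measurableTypeR R) n (fun i => `[a i, a i + s[%classic)) =
  (s ^+ n)%:E.
Proof.
move=> s0; rewrite /lebesgue_tuple [LHS]power_measure_box; last first.
  by move=> i; exact: measurable_itv.
transitivity (\prod_(i < n) s%:E)%E.
  apply: eq_bigr => i _; rewrite [LHS]lebesgue_measure_itv/= lte_fin.
  rewrite ltrDl; case: ltP => [_|sle].
    by rewrite -EFinB addrAC subrr add0r.
  by congr EFin; apply/eqP; rewrite eq_le s0 sle.
by rewrite prodEFin prodr_const card_ord.
Qed.

Definition affine_hyperplane n (a : nat -> R) (c : R) :
    set (n.-tuple (measurableTypeR R)) :=
  [set y | \sum_(i < n) a i * tnth y i = c].

Lemma measurable_affine_hyperplane n a c : measurable (@affine_hyperplane n a c).
Proof.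
rewrite (_ : affine_hyperplane _ _ = setT `&`
    (fun y : n.-tuple (measurableTypeR R) =>
       \sum_(i < n) a i * tnth y i) @^-1` [set c]); last by rewrite setTI.
apply: measurable_sum => // i; apply: measurable_funM => //.
exact: measurable_tnth.
Qed.

(** If some coefficient other than the first is nonzero, the slice at each value
    of the first coordinate is a hyperplane of lower dimension, and Fubini's
    theorem applies.  Otherwise the equation fixes the first coordinate, and
    the hyperplane is the product of a point with the whole space. *)
Lemma affine_hyperplane_null n (a : nat -> R) (c : R) :
  (exists i : 'I_n, a i != 0) ->
  lebesgue_tuple R n (affine_hyperplane a c) = 0%E.
Proof.
rewrite /lebesgue_tuple.
elim: n a c => [|n IH] a c; first by case=> -[].
have [[i ai] _|a0 [i ai]] := pselect (exists i : 'I_n, a i.+1 != 0).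
  rewrite [LHS]power_measureS.
  rewrite /product_measure1; apply: integral0_eq => x _.
  have := IH (a \o S) (c - a 0%N * x) (ex_intro _ i ai).
  congr (_ = _); congr (power_measure _ _ _).
  apply/seteqP; split=> t; rewrite /xsection/= inE /affine_hyperplane /=.
    move=> h; rewrite big_ord_recl tnth_tuple_cons0/=.
    under eq_bigr do rewrite tnth_tuple_consS.
    by rewrite h addrC subrK.
  rewrite big_ord_recl tnth_tuple_cons0/= => <-; rewrite addrAC subrr add0r.
  by apply: eq_bigr => j _; rewrite tnth_tuple_consS.
have a0' (j : 'I_n) : a j.+1 = 0.
  by apply/eqP; apply: contrapT => /negP h; apply: a0; exists j.
have {}ai : a 0%N != 0.
  case: (unliftP ord0 i) => [j|] ij; last by rewrite ij in ai.
  by move: ai; rewrite ij lift0 a0' eqxx.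
rewrite [LHS]power_measureS.
rewrite (_ : _ @^-1` _ = [set c / a 0%N] `*` setT).
  rewrite [LHS]product_measure1E//.
  by rewrite [X in (X * _)%E]lebesgue_measure_set1 mul0e.
apply/seteqP; split=> x;
  rewrite /affine_hyperplane/= big_ord_recl tnth_tuple_cons0/=.
  rewrite big1 ?addr0; last by move=> j _; rewrite a0' mul0r.
  by move=> <-; split=> //; rewrite mulrAC divff// mul1r.
move=> [-> _]; rewrite big1 ?addr0; last by move=> j _; rewrite a0' mul0r.
by rewrite mulrC divfK.
Qed.
End lebesgue_tuple_theory.

(** * Weak convergence of images of uniform distributions *)

(** For [E] of positive mass, hypothesis [PE] below says that [P] is the image
    under [phi] of the normalization of [mu] on [E].  Without a division it
    also makes sense for a region of mass [0], which occurs for small [n] when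
    no partition is available. *)
Section image_of_uniform.
Context d d' (T : measurableType d) (T' : measurableType d') (R : realType).
Variables (mu : {measure set T -> \bar R}) (E : set T) (phi : T -> T').
Hypotheses (mE : measurable E) (mphi : measurable_fun setT phi).
Hypothesis (Efin : (mu E < +oo)%E).
Variable P : probability T' R.
Hypothesis PE : forall U, measurable U ->
  (mu E * P U = mu (E `&` phi @^-1` U))%E.

Let ge0_integral_image (g : T' -> \bar R) : measurable_fun setT g ->
  (forall x, 0 <= g x)%E ->
  (mu E * \int[P]_x g x = \int[mu]_(y in E) g (phi y))%E.
Proof.
move=> mg g0.
have mEfin : mu E \is a fin_num by rewrite ge0_fin_numE.
pose c : {nonneg R} := NngNum (fine_ge0 (measure_ge0 mu E)).
have cE : c%:num%:E = mu E by rewrite /= fineK.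
rewrite -cE.
rewrite -ge0_integral_mscale//.
rewrite (eq_measure_integral (pushforward (mrestr mu mE) phi)); last first.
  move=> U mU _; transitivity (c%:num%:E * P U)%E => //; rewrite cE PE//.
  by rewrite /pushforward/= /mrestr setIC.
rewrite ge0_integral_pushforward// preimage_setT -(setvU E).
have mgphi : measurable_fun setT (g \o phi) by exact: measurableT_comp.
have mEC := measurableC mE.
rewrite ge0_integral_setU//=.
- rewrite [X in (X + _)%E]null_set_integral ?add0e//.
  + apply: (@eq_measure_integral _ T R E mu (mrestr mu mE)) => A mA AE.
    by rewrite /= /mrestr setIidl.
  + exact: measurable_funTS.
  + by rewrite /= /mrestr setICl measure0.
- exact: measurable_funTS.
- exact/disj_setPLR.
Qed.

(** Both sides split into positive and negative parts; for a nonnegative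
    function this is a change of variables, the scaled measure [mu E * P]
    being the image of [mu] restricted to [E]. *)
Lemma integral_image_of_uniform (f : T' -> R) :
  measurable_fun setT f -> bounded_fun f ->
  (mu E * \int[P]_x (f x)%:E = \int[mu]_(y in E) (f (phi y))%:E)%E.
Proof.
move=> mf bf.
have mEfin : mu E \is a fin_num by rewrite ge0_fin_numE.
have fP : P.-integrable setT (EFin \o f).
  apply: measurable_bounded_integrable => //.
  by rewrite [ltLHS]probability_setT ltry.
rewrite [in LHS]integralE [RHS]integralE muleBr//; last first.
  apply: fin_num_adde_defr; apply: (integrable_fin_num measurableT).
  exact: (integrable_funepos measurableT fP).
rewrite !ge0_integral_image//.
- by congr (_ - _)%E; apply: eq_integral => y _; rewrite ?funeposE ?funenegE.
- exact/measurable_funeneg/measurable_EFinP.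
- exact/measurable_funepos/measurable_EFinP.
Qed.

End image_of_uniform.

Lemma continuous_rV_measurable (R : realType) m (f : 'rV[R]_m -> R) :
  continuous f -> measurable_fun setT (f : borel 'rV[R]_m -> R).
Proof.
move=> cf; apply: (measurability _ (RGenOpens.measurableE R)).
move=> _ [_ [a [b ->]] <-]; rewrite setTI; apply: sub_sigma_algebra.
by apply: open_comp => [x _|]; [exact: cf|exact: interval_open].
Qed.

Section weak_convergence.
Context d (T : measurableType d) (R : realType) (m : nat).
Variables (mu : {measure set T -> \bar R}) (B E : set T) (E_ : nat -> set T).
Variables (phi : T -> borel 'rV[R]_m) (phi_ : nat -> T -> borel 'rV[R]_m).
Hypotheses (mB : measurable B) (mE : measurable E).
Hypothesis mE_ : forall n, measurable (E_ n).
Hypotheses (mphi : measurable_fun setT phi).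
Hypothesis mphi_ : forall n, measurable_fun setT (phi_ n).
Hypotheses (Bfin : (mu B < +oo)%E) (EB : E `<=` B).
Hypothesis E_B : forall n, E_ n `<=` B.
Hypothesis cvg_E : {ae mu, forall y,
  (\forall n \near \oo, E_ n y <-> E y) /\
  (E y -> (phi_ n y : 'rV[R]_m) @[n --> \oo] --> (phi y : 'rV[R]_m))}.

(** The integrands extended by [0] off the regions converge almost everywhere
    on the fixed set [B] of finite measure and are dominated by a bound of
    [f]. *)
Let cvg_integral (f : 'rV[R]_m -> R) : continuous f -> bounded_fun f ->
  (\int[mu]_(y in E_ n) (f (phi_ n y))%:E @[n --> \oo] -->
   \int[mu]_(y in E) (f (phi y))%:E)%E.
Proof.
move=> cf bf; have mf := continuous_rV_measurable cf.
have mg n : measurable_fun setT (fun y => (f (phi_ n y))%:E).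
  by apply/measurable_EFinP; exact: measurableT_comp mf (mphi_ n).
have mg' : measurable_fun setT (fun y => (f (phi y))%:E).
  by apply/measurable_EFinP; exact: measurableT_comp mf mphi.
rewrite (_ : (fun n => _) = (fun n =>
    \int[mu]_(y in B) (((fun y => (f (phi_ n y))%:E) \_ (E_ n)) y))%E);
  last first.
  by apply/funext => n; rewrite -integral_mkcondr setIidr.
rewrite -(setIidr EB) integral_mkcondr.
have [M0 [_ Mf]] := bf; pose M := `|M0| + 1.
have {}Mf x : `|f x| <= M by apply: Mf; rewrite // ltr_pwDr// ler_norm.
have M_ge0 : 0 <= M by rewrite addr_ge0.
pose F_ n := (fun y => (f (phi_ n y))%:E) \_ (E_ n).
pose F := (fun y => (f (phi y))%:E) \_ E.
suff [] : [/\ mu.-integrable B F,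
  [sequence \int[mu]_(x in B) `|F_ n x - F x|]_n @ \oo --> 0%E &
  (\int[mu]_(x in B) F_ n x @[n --> \oo] --> \int[mu]_(x in B) F x)]%E by [].
apply: (@dominated_convergence _ _ _ mu B mB F_ F (cst M%:E)) => //.
- move=> n; apply/measurable_restrict => //.
  exact: measurable_funS (mg n).
- apply/measurable_restrict => //.
  exact: measurable_funS mg'.
- apply: filterS cvg_E => y [EE cphi] _.
  have [Ey|nEy] := pselect (E y).
    apply: (@cvg_trans _ ((f (phi_ n y))%:E @[n --> \oo])).
      apply: near_eq_cvg; near=> n; rewrite /F_ patchE mem_set//.
      have [_] : E_ n y <-> E y by near: n.
      exact.
    rewrite /F patchE mem_set//; apply: cvg_EFin; first by near=> n.
    exact: cvg_comp (cphi Ey) (cf (phi y)).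
  rewrite /F patchE memNset//; apply: cvg_near_cst; near=> n.
  rewrite /F_ patchE memNset// => E_y; apply: nEy.
  have [+ _] : E_ n y <-> E y by near: n.
  exact.
- apply: (@measurable_bounded_integrable _ _ _ mu (cst M)) => //.
  exact: bounded_cst.
- apply: aeW => y n _; rewrite /F_ patchE; case: ifP => _;
    last by rewrite abse0 lee_fin.
  by rewrite /= lee_fin.
Unshelve. all: by end_near. Qed.

Variables (P_ : nat -> probability (borel 'rV[R]_m) R).
Variable (P : probability (borel 'rV[R]_m) R).
Hypothesis E_gt0 : (0 < mu E)%E.
Hypothesis P_E : forall n U, measurable U ->
  (mu (E_ n) * P_ n U = mu (E_ n `&` phi_ n @^-1` U))%E.
Hypothesis PE : forall U, measurable U ->
  (mu E * P U = mu (E `&` phi @^-1` U))%E.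

(** The expectation of [f] is the quotient of its integral over the region by
    the mass of the region.  Both converge by dominated convergence, the mass
    being the case [f = 1], and the limit of the mass is nonzero. *)
Lemma weak_cvg_image_of_uniform : weak_cvg P_ P.
Proof.
move=> f cf bf; have mf := continuous_rV_measurable cf.
have finB A : measurable A -> A `<=` B -> (mu A < +oo)%E.
  by move=> mA AB; apply: le_lt_trans Bfin; rewrite le_measure ?inE.
have finS A : measurable A -> A `<=` B -> mu A \is a fin_num.
  by move=> mA AB; rewrite ge0_fin_numE// finB.
have cvg_mass : mu (E_ n) @[n --> \oo] --> (fine (mu E))%:E.
  rewrite fineK ?finS//.
  have c1 : continuous (cst 1 : 'rV[R]_m -> R) by exact: cst_continuous.
  have := cvg_integral c1 (bounded_cst (1 : R^o) setT).
  have mass A (psi : T -> borel 'rV[R]_m) : measurable A ->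
      (\int[mu]_(y in A) ((cst 1 : 'rV[R]_m -> R) (psi y))%:E)%E = mu A.
    by move=> mA; rewrite -[RHS]mul1e -(integral_cst mu mA).
  rewrite mass//; apply: cvg_trans; apply: near_eq_cvg; near=> n.
  by rewrite mass.
have Pfin (Q : probability (borel 'rV[R]_m) R) :
    (\int[Q]_x (f x)%:E)%E \is a fin_num.
  apply: integrable_fin_num => //; apply: measurable_bounded_integrable => //.
  by rewrite [ltLHS]probability_setT ltry.
have E0 : fine (mu E) != 0 by rewrite gt_eqF// fine_gt0// E_gt0 finB.
have fineP (Q : probability (borel 'rV[R]_m) R) (A : set T)
    (psi : T -> borel 'rV[R]_m) :
    measurable A -> A `<=` B -> measurable_fun setT psi ->
    (forall U, measurable U -> (mu A * Q U = mu (A `&` psi @^-1` U))%E) ->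
    (\int[mu]_(y in A) (f (psi y))%:E)%E
      = (fine (mu A) * fine (\int[Q]_x (f x)%:E)%E)%:E.
  move=> mA AB mpsi QA.
  rewrite -(integral_image_of_uniform mA mpsi (finB _ mA AB) QA)//.
  by rewrite EFinM !fineK// finS.
have := cvg_integral cf bf.
rewrite (fineP P)// => /fine_cvg /= cvgI.
rewrite -(fineK (Pfin P)); apply: cvg_EFin; first by near=> n; exact: Pfin.
have cvg_m : fine (mu (E_ n)) @[n --> \oo] --> fine (mu E).
  exact: fine_cvg cvg_mass.
have : (fine (mu (E_ n)))^-1 * fine (\int[mu]_(y in E_ n) (f (phi_ n y))%:E)%E
    @[n --> \oo] -->
  (fine (mu E))^-1 * (fine (mu E) * fine (\int[P]_x (f x)%:E)%E).
  apply: cvgM cvgI; exact: cvgV E0 cvg_m.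
rewrite mulKf//.
apply: cvg_trans; apply: near_eq_cvg; near=> n.
rewrite (fineP (P_ n))//=; last exact: P_E.
rewrite mulKf//.
by near: n; exact: cvgr_neq0 cvg_m E0.
Unshelve. all: by end_near. Qed.
End weak_convergence.

(** * Rounding a point down to a partition *)

Lemma measurable_fun_natP d (T : measurableType d) (f : T -> nat) :
  (forall k, measurable [set x | (k < f x)%N]) -> measurable_fun setT f.
Proof.
move=> mf _ Y _; rewrite setTI.
have m1 k : measurable (f @^-1` [set k]).
  rewrite (_ : _ @^-1` _ = ~` [set x | (k < f x)%N] `\`
      (if k is k'.+1 then ~` [set x | (k' < f x)%N] else set0)).
    apply: measurableD; first exact/measurableC.
    by case: k => [//|k]; exact/measurableC.
  apply/seteqP; split=> x /=.
    move=> fx; split; first by rewrite fx ltnn.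
    by case: k fx => [_ []|k fx h]; apply: h; rewrite /= fx.
  move=> [/negP]; rewrite -leqNgt; case: k => [|k] fk.
    by move=> _; apply/eqP; rewrite -leqn0.
  by move=> /contrapT kf; apply/eqP; rewrite eqn_leq fk.
rewrite (_ : f @^-1` Y = \bigcup_(k in Y) (f @^-1` [set k])).
  by apply: bigcup_measurable.
by apply/seteqP; split=> [x Yx|x [k Yk /= ->//]]; exists (f x).
Qed.

Section floor_partition.
Variables (R : realType) (d : nat).
Implicit Types (n : nat) (y : d.-tuple (measurableTypeR R)).
Implicit Types (k : d.+1.-tuple nat).

(** The last coordinate is computed from the others, hence this way of
    splitting the indices. *)
Lemma ord_recr_ind (Q : 'I_d.+1 -> Prop) :
  (forall j : 'I_d, Q (widen_ord (leqnSn d) j)) -> Q ord_max -> forall i, Q i.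
Proof.
move=> Qw Qm i; have [id|di] := ltnP i d.
  have -> : i = widen_ord (leqnSn d) (Ordinal id) by exact: val_inj.
  exact: Qw.
suff -> : i = ord_max by [].
by apply: val_inj; apply/eqP; rewrite /= eqn_leq di andbT -ltnS.
Qed.

(** This is the integral counterpart of [hyperplane_point].  The subtraction is
    truncated: when the integer parts add up to more than [n], the result does
    not have sum [n] and therefore belongs to no set of partitions of [n]. *)
Definition floor_partition n y : d.+1.-tuple nat :=
  [tuple nth (n - \sum_(j < d) Num.truncn (n%:R * tnth y j))%N
    [seq Num.truncn (n%:R * z) | z <- y] i | i < d.+1].

Lemma floor_partition_widen n y (j : 'I_d) :
  tnth (floor_partition n y) (widen_ord (leqnSn d) j)
  = Num.truncn (n%:R * tnth y j).
Proof.
rewrite tnth_mktuple (tnth_nth 0) (nth_map 0)// size_tuple.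
exact: ltn_ord j.
Qed.

Lemma floor_partition_max n y :
  tnth (floor_partition n y) ord_max =
  (n - \sum_(j < d) Num.truncn (n%:R * tnth y j))%N.
Proof. by rewrite tnth_mktuple nth_default// size_map size_tuple. Qed.

Lemma hyperplane_point_widen y (j : 'I_d) :
  (@hyperplane_point R d.+1 y : 'rV[R]_d.+1) ord0 (widen_ord (leqnSn d) j) =
  tnth y j.
Proof. by rewrite mxE [RHS](tnth_nth (1 - \sum_(j < d) tnth y j)). Qed.

Lemma hyperplane_point_max y :
  (@hyperplane_point R d.+1 y : 'rV[R]_d.+1) ord0 ord_max
  = 1 - \sum_(j < d) tnth y j.
Proof. by rewrite mxE nth_default// size_tuple. Qed.

Lemma sum_hyperplane_point y :
  \sum_i (@hyperplane_point R d.+1 y : 'rV[R]_d.+1) ord0 i = 1.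
Proof.
rewrite big_ord_recr/= hyperplane_point_max addrC.
under [X in _ + X]eq_bigr do rewrite hyperplane_point_widen.
by rewrite subrK.
Qed.

Lemma sumn_tuple_recr k :
  sumn k = (\sum_(j < d) tnth k (widen_ord (leqnSn d) j) + tnth k ord_max)%N.
Proof. by rewrite sumnE big_tuple big_ord_recr. Qed.

Lemma sumn_floor_partition n y :
  (sumn (floor_partition n y) == n) =
  (\sum_(j < d) Num.truncn (n%:R * tnth y j) <= n)%N.
Proof.
rewrite sumn_tuple_recr floor_partition_max.
under eq_bigr do rewrite floor_partition_widen.
apply/eqP/idP => [h|/subnKC//].
by rewrite -[X in (_ <= X)%N]h leq_addr.
Qed.

(** Each of the first coordinates loses less than [1] by rounding, and the last
    one collects the [d] losses. *)
Lemma floor_partition_close n y :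
  (forall i, 0 <= tnth y i) -> sumn (floor_partition n y) = n ->
  forall i, `|(tnth (floor_partition n y) i)%:R
    - n%:R * (@hyperplane_point R d.+1 y : 'rV[R]_d.+1) ord0 i| <= d.+1%:R.
Proof.
move=> y0 /eqP; rewrite sumn_floor_partition => le_n.
have tr (j : 'I_d) : 0 <= n%:R * tnth y j - (Num.truncn (n%:R * tnth y j))%:R <= 1.
  have /truncn_itv/andP[t1 t2] : 0 <= n%:R * tnth y j by rewrite mulr_ge0.
  by rewrite subr_ge0 t1/= lerBlDl natr1 ltW.
apply: ord_recr_ind => [j|].
  rewrite floor_partition_widen hyperplane_point_widen distrC.
  have /andP[t1 t2] := tr j.
  by rewrite ger0_norm// (le_trans t2)// ler1n.
rewrite floor_partition_max hyperplane_point_max natrB//.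
rewrite (_ : _ - _ = \sum_(j < d)
    (n%:R * tnth y j - (Num.truncn (n%:R * tnth y j))%:R)); last first.
  by rewrite sumrB -mulr_sumr -natr_sum; ring.
rewrite ger0_norm; last by apply: sumr_ge0 => j _; have /andP[] := tr j.
apply: (@le_trans _ _ (\sum_(j < d) 1)).
  by apply: ler_sum => j _; have /andP[] := tr j.
by rewrite sumr_const card_ord ler_nat.
Qed.

(** Negative coordinates are discarded because [Num.truncn] sends them to [0]:
    otherwise the cell of a partition with a zero among its first [d] parts
    would be unbounded. *)
Definition floor_cell n (V : set (d.+1.-tuple nat)) :
    set (d.-tuple (measurableTypeR R)) :=
  [set y | (forall i, 0 <= tnth y i) /\ V (floor_partition n y)].

Lemma floor_cell1E n k : (0 < n)%N -> sumn k = n ->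
  floor_cell n [set k] = @box _ (measurableTypeR R) d (fun i =>
    `[(nth 0%N k i)%:R / n%:R, (nth 0%N k i)%:R / n%:R + n%:R^-1[%classic).
Proof.
move=> n0 kn; have n0R : 0 < n%:R :> R by rewrite ltr0n.
have itvE y (i : 'I_d) :
    (`[(nth 0%N k i)%:R / n%:R, (nth 0%N k i)%:R / n%:R + n%:R^-1[%classic
       (tnth y i)) = ((tnth k (widen_ord (leqnSn d) i))%:R
       <= n%:R * tnth y i < (tnth k (widen_ord (leqnSn d) i)).+1%:R) :> Prop.
  rewrite /= in_itv/= (tnth_nth 0%N) ler_pdivrMr// mulrC.
  by rewrite -[X in _ + X]mul1r -mulrDl ltr_pdivlMr// natr1 [tnth _ _ * _]mulrC.
apply/seteqP; split=> [y [y0 yk] i|y yk].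
  rewrite itvE -yk floor_partition_widen truncn_itv//.
  by rewrite mulr_ge0.
have yt (i : 'I_d) :
    Num.truncn (n%:R * tnth y i) = tnth k (widen_ord (leqnSn d) i).
  by apply: truncn_def; have := yk i; rewrite itvE.
split=> [i|].
  have := yk i; rewrite itvE => /andP[+ _].
  by move=> /(le_trans (ler0n _ _)); rewrite pmulr_rge0.
apply: eq_from_tnth; apply: ord_recr_ind => [j|].
  by rewrite floor_partition_widen yt.
rewrite floor_partition_max; under eq_bigr do rewrite yt.
by rewrite -[X in (X - _)%N]kn sumn_tuple_recr addKn.
Qed.

Lemma lebesgue_floor_cell1 n k : (0 < n)%N -> sumn k = n ->
  lebesgue_tuple R d (floor_cell n [set k]) = (n%:R^-1 ^+ d)%:E.
Proof.
move=> n0 kn; rewrite floor_cell1E//.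
by rewrite (lebesgue_tuple_cube d (fun i => (nth 0%N k i)%:R / n%:R)).
Qed.

Lemma finite_sumn_eq n (V : set (d.+1.-tuple nat)) :
  (forall k, V k -> sumn k = n) -> finite_set V.
Proof.
move=> Vn; pose g (t : d.+1.-tuple 'I_n.+1) : d.+1.-tuple nat := map_tuple val t.
apply: (@sub_finite_set _ _ (range g)); last exact: finite_image.
move=> k Vk; exists [tuple inord (tnth k i) | i < d.+1] => //.
apply: eq_from_tnth => i; rewrite tnth_map tnth_mktuple /= inordK// ltnS -(Vn _ Vk).
by rewrite sumnE big_tuple (bigD1 i)//= leq_addr.
Qed.

(** The cells of the elements of [V] are disjoint cubes of the same volume, so
    that rounding transports the Lebesgue measure to a multiple of the counting
    measure. *)
Lemma lebesgue_floor_cell n (V : set (d.+1.-tuple nat)) : (0 < n)%N ->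
  (forall k, V k -> sumn k = n) ->
  lebesgue_tuple R d (floor_cell n V) = ((n%:R^-1 ^+ d)%:E * counting V)%E.
Proof.
move=> n0 Vn; have fV := finite_sumn_eq Vn.
have -> : floor_cell n V = \bigcup_(k in V) floor_cell n [set k].
  apply/seteqP; split=> [y [y0 yV]|y [k Vk [y0 yk]]].
    by exists (floor_partition n y).
  by split=> //; rewrite yk.
rewrite measure_fin_bigcup//=.
- rewrite /counting asboolT// fsbig_finite//=.
  under eq_big_seq => k.
    rewrite in_fset_set// inE => /Vn kn; rewrite lebesgue_floor_cell1//; over.
  by rewrite sumEFin big_const_seq count_predT iter_addr_0 -EFinM mulr_natr.
- by move=> k l _ _ [y [[_ <-] [_ <-]]].
- move=> k /Vn kn; rewrite floor_cell1E//; apply: measurable_box => i.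
  exact: measurable_itv.
Qed.

Lemma measurable_floor_partition n : measurable_fun setT (@floor_partition n).
Proof.
have mtr (j : 'I_d) : measurable_fun setT
    (fun y : d.-tuple (measurableTypeR R) => Num.truncn (n%:R * tnth y j)).
  apply: measurable_fun_natP => k.
  rewrite (_ : mkset _ = (fun y : d.-tuple (measurableTypeR R) =>
      n%:R * tnth y j) @^-1` `[k.+1%:R, +oo[); last first.
    by apply/seteqP; split=> y /=; rewrite in_itv/= andbT truncn_gt_nat.
  rewrite -[X in measurable X]setTI.
  by apply: measurable_funM => //; exact: measurable_tnth.
apply/measurable_fun_tnthP; apply: ord_recr_ind => [j|].
  rewrite (_ : _ \o _ = fun y => Num.truncn (n%:R * tnth y j))//.
  by apply/funext => y /=; rewrite floor_partition_widen.
rewrite (_ : _ \o _ = fun y =>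
    (n - \sum_(j < d) Num.truncn (n%:R * tnth y j))%N); last first.
  by apply/funext => y /=; rewrite floor_partition_max.
apply: measurable_fun_subn => //.
elim: (index_enum _) => [|j s IH].
  by rewrite (_ : (fun y => _) = cst 0%N)//; apply/funext => y; rewrite big_nil.
rewrite (_ : (fun y => _) = (fun y => Num.truncn (n%:R * tnth y j) +
    \sum_(i <- s) Num.truncn (n%:R * tnth y i))%N).
  exact: measurable_fun_addn.
by apply/funext => y; rewrite big_cons.
Qed.

Lemma measurable_floor_cell n V : measurable (floor_cell n V).
Proof.
rewrite (_ : floor_cell n V = (\bigcap_(i in [set: 'I_d])
    ((@tnth d (measurableTypeR R) ^~ i) @^-1` `[0, +oo[)) `&`
    (@floor_partition n @^-1` V)).
  apply: measurableI.
    apply: fin_bigcap_measurable => // i _.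
    rewrite -[X in measurable X]setTI.
    by apply: measurable_tnth => //; exact: measurable_itv.
  rewrite -[X in measurable X]setTI.
  by apply: measurable_floor_partition => //; exact: measurable_tuple_nat.
apply/seteqP; split=> [y [y0 yV]|y [y0 yV]]; split=> // i.
  by move=> _; rewrite /= in_itv/= andbT y0.
by have := y0 i I; rewrite /= in_itv/= andbT.
Qed.
End floor_partition.

(** * The chart of the ordered simplex *)

(** Multiplying by [mu A] makes the identity valid also when [mu A] is [0],
    where [uniform_law] takes a default value: both sides then vanish. *)
Lemma uniform_law_mass d (T : measurableType d) (R : realType)
    (mu : {measure set T -> \bar R}) (A : set T) (mA : measurable A) U :
  measurable U -> (mu A < +oo)%E ->
  (mu A * uniform_law mu mA U = mu (A `&` U))%E.
Proof.
move=> mU Afin; have Afin_num : mu A \is a fin_num by rewrite ge0_fin_numE.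
have [A0|A0] := eqVneq (mu A) 0%E.
  rewrite A0 mul0e; apply/esym/eqP; rewrite eq_le measure_ge0 andbT -A0.
  apply: le_measure; rewrite ?inE//; exact: measurableI.
rewrite /uniform_law /= /mnormalize /= /mrestr setTI (negbTE A0)/=.
rewrite lt_eqF//= setIC muleCA -[X in (_ * (X * _))%E](fineK Afin_num) -EFinM.
by rewrite divff ?mule1//= fine_eq0.
Qed.

Section simplex.
Variables (R : realType) (d : nat).
Hypothesis d_gt0 : (0 < d)%N.
Local Notation T := (d.-tuple (measurableTypeR R)).
Local Notation leb := (lebesgue_tuple R d).
Local Notation hp := (@hyperplane_point R d.+1).
Local Notation co y := (hp y : 'rV[R]_d.+1).
Local Notation K := (d.+1%:R : R).
Implicit Types (y : T) (i j : 'I_d.+1).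

Definition simplex_chart : set T := hp @^-1` (ordered_simplex R d.+1).

Lemma simplex_chartP y : (forall i, 0 <= co y ord0 i) ->
  (forall i j, (i < j)%N -> co y ord0 j < co y ord0 i) -> simplex_chart y.
Proof.
move=> y0 ydec; split=> // [i|]; last exact: sum_hyperplane_point.
rewrite y0 -(sum_hyperplane_point y) (bigD1 i)//= lerDl.
by apply: sumr_ge0 => j _; exact: y0.
Qed.

Lemma measurable_simplex_chart : measurable simplex_chart.
Proof.
rewrite -[X in measurable X]setTI.
exact: (@hyperplane_point_measurable R d.+1 measurableT _
  (@ordered_simplex_measurable R d.+1)).
Qed.

(** Coefficients of the [i]-th coordinate of [hyperplane_point], an affine
    function of [y]; the index [d] is that of the last coordinate. *)
Definition coord_coef (i k : nat) : R := if i == d then -1 else (k == i)%:R.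

Lemma hyperplane_point_affine y i :
  co y ord0 i = (i == d :> nat)%:R + \sum_(k < d) coord_coef i k * tnth y k.
Proof.
move: i; apply: ord_recr_ind => [j|].
  rewrite hyperplane_point_widen /coord_coef /= ltn_eqF// add0r (bigD1 j)//= eqxx.
  rewrite mul1r big1 ?addr0// => k kj.
  by rewrite (negbTE (_ : (k != j :> nat)))// mul0r.
rewrite hyperplane_point_max /coord_coef /= eqxx; congr (_ + _).
by rewrite -sumrN; apply: eq_bigr => k _; rewrite mulN1r.
Qed.

(** These points avoid the faces of the ordered simplex, where membership may
    not be stable under rounding.  Each excluded condition is an affine equation
    in [y] whose coefficients are not all zero. *)
Lemma hyperplane_point_generic : {ae leb, forall y,
  (forall i j, (i < j)%N -> co y ord0 i != co y ord0 j) /\ co y ord0 ord_max != 0}.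
Proof.
have neg (a : nat -> R) c (Q : T -> Prop) : (exists i : 'I_d, a i != 0) ->
    (forall y, ~ Q y -> \sum_(i < d) a i * tnth y i = c) ->
    {ae leb, forall y, Q y}.
  move=> a0 Qa; apply: (@negligibleS _ _ _ leb (affine_hyperplane a c)) => //.
  apply/negligibleP; first exact: measurable_affine_hyperplane.
  exact: affine_hyperplane_null.
have max_neq0 : {ae leb, forall y, co y ord0 ord_max != 0}.
  apply: (neg (coord_coef d) (- 1)).
    by exists (Ordinal d_gt0); rewrite /coord_coef eqxx oppr_eq0 oner_eq0.
  move=> y /negP; rewrite negbK hyperplane_point_affine /= eqxx => /eqP h.
  by apply: (addrI 1); rewrite h subrr.
suff neq : {ae leb, forall y i j, (i < j)%N -> co y ord0 i != co y ord0 j}.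
  by apply: filterS2 neq max_neq0 => y.
apply: filter_forall => i; apply: filter_forall => j.
have [ij|ij] := ltnP i j; last by apply: aeW.
apply: (neg (fun k => coord_coef i k - coord_coef j k)
  ((j == d :> nat)%:R - (i == d :> nat)%:R)).
  have id : (i < d)%N by rewrite (leq_trans ij)// -ltnS.
  exists (Ordinal id); rewrite /coord_coef /= (ltn_eqF id) eqxx.
  case: ifP => _; first by rewrite opprK -[1 + 1]/(2%:R) pnatr_eq0.
  by rewrite (ltn_eqF ij) subr0 oner_eq0.
move=> y /(contra_notP _) h; have /eqP : co y ord0 i == co y ord0 j.
  by apply: contrapT => /negP h'; apply: h => _.
rewrite !hyperplane_point_affine => e.
under eq_bigr do rewrite mulrBl.
rewrite sumrB; lra.
Qed.

Section near_simplex.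
Variables (n : nat) (y : T).
Local Notation k := (floor_partition n y).
Hypothesis close : forall i, `|(tnth k i)%:R - n%:R * co y ord0 i| <= K.

Lemma floor_partition_lt i j : 2 * K < n%:R * (co y ord0 i - co y ord0 j) ->
  (tnth k j < tnth k i)%N.
Proof.
move=> h; rewrite -(ltr_nat R).
have := close i; have := close j; rewrite !ler_norml => /andP[? ?] /andP[? ?].
rewrite mulrBr in h; lra.
Qed.

Lemma floor_partition_gt0 i : K < n%:R * co y ord0 i -> (0 < tnth k i)%N.
Proof.
move=> h; rewrite -(ltr_nat R).
have := close i; rewrite !ler_norml => /andP[? ?]; lra.
Qed.
End near_simplex.

Lemma tnth_sorted_geq (k : d.+1.-tuple nat) i j :
  sorted geq k -> (i <= j)%N -> (tnth k j <= tnth k i)%N.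
Proof.
move=> sk ij; rewrite !(tnth_nth 0%N).
have geq_tr : transitive geq by move=> a b c ab bc; exact: leq_trans bc ab.
by apply: (sorted_leq_nth geq_tr leqnn 0%N sk); rewrite ?inE ?size_tuple.
Qed.

Lemma sorted_geq_tuple (k : d.+1.-tuple nat) :
  (forall i j, (i < j)%N -> (tnth k j < tnth k i)%N) -> sorted geq k.
Proof.
move=> dec; apply/(sortedP 0%N) => i; rewrite size_tuple => iS.
have id : (i < d.+1)%N by exact: ltnW.
have := dec (Ordinal id) (Ordinal iS) (ltnSn i).
by rewrite !(tnth_nth 0%N) /= => /ltnW.
Qed.

(** The chart contains a whole cell, that of a partition whose parts are so far
    apart that rounding cannot alter their order. *)
Lemma simplex_chart_gt0 : (0 < leb simplex_chart)%E.
Proof.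
(* Rounding moves each part by at most [d.+1], so gaps and a last part larger
   than [2 * d.+1] are enough. *)
pose k : d.+1.-tuple nat := [tuple ((d.+1 - i) * (2 * d.+1).+1)%N | i < d.+1].
pose n := sumn k.
have k_gt i : ((2 * d.+1).+1 <= tnth k i)%N.
  by rewrite tnth_mktuple leq_pmull// subn_gt0 ltn_ord.
have n0 : (0 < n)%N.
  rewrite /n sumn_tuple_recr; apply: leq_trans (leq_addl _ _).
  exact: leq_trans (k_gt _).
have nR : 0 < n%:R :> R by rewrite ltr0n.
apply: (@lt_le_trans _ _ (leb (floor_cell n [set k]))).
  by rewrite lebesgue_floor_cell1// lte_fin exprn_gt0// invr_gt0.
apply: le_measure; rewrite ?inE.
- exact: measurable_floor_cell.
- exact: measurable_simplex_chart.
move=> y [y0 yk]; have kn : sumn (floor_partition n y) = n by rewrite yk.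
have := floor_partition_close y0 kn; rewrite yk => close.
apply: simplex_chartP => [i|i j ij].
  have := close i; have := k_gt i; rewrite -(ler_nat R) ler_norml.
  rewrite -natr1 natrM => ? /andP[? ?].
  have K0 : 0 <= K by [].
  rewrite -(pmulr_rge0 _ nR); lra.
have : ((2 * d.+1).+1 + tnth k j <= tnth k i)%N.
  by rewrite !tnth_mktuple -mulSn leq_mul2r/= ltn_sub2l.
rewrite -(ler_nat R) natrD -natr1 natrM -(ltr_pM2l nR) => ?.
have := close i; have := close j; rewrite !ler_norml => /andP[? ?] /andP[? ?].
lra.
Qed.
End simplex.

(** * Convergence of the rescaled partitions *)

Section limit.
Variables (R : realType) (d : nat).
Hypothesis d_gt0 : (0 < d)%N.
Local Notation T := (d.-tuple (measurableTypeR R)).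
Local Notation leb := (lebesgue_tuple R d).
Local Notation hp := (@hyperplane_point R d.+1).
Local Notation co y := (hp y : 'rV[R]_d.+1).
Local Notation K := (d.+1%:R : R).
Local Notation D := (@simplex_chart R d).
Implicit Types (y : T) (i j : 'I_d.+1).

Definition bounding_cube : set T :=
  @box _ (measurableTypeR R) d (fun=> `[0, 0 + 2[%classic).

Lemma measurable_bounding_cube : measurable bounding_cube.
Proof. by apply: measurable_box => i; exact: measurable_itv. Qed.

Lemma bounding_cube_lty : (leb bounding_cube < +oo)%E.
Proof. by rewrite (lebesgue_tuple_cube d (fun=> 0))// ltry. Qed.

Lemma simplex_chart_sub : D `<=` bounding_cube.
Proof.
move=> y [y01 _ _] i; have := y01 (widen_ord (leqnSn d) i).
rewrite hyperplane_point_widen /= in_itv/= => /andP[-> ?].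
lra.
Qed.

Lemma floor_cell_sub n (V : set (d.+1.-tuple nat)) : (0 < n)%N ->
  (forall k, V k -> sumn k = n) -> floor_cell n V `<=` bounding_cube.
Proof.
move=> n0 Vn y [y0 /Vn/eqP]; rewrite sumn_floor_partition => le_n i.
rewrite /= in_itv/= y0/= add0r.
have nR : 1 <= n%:R :> R by rewrite ler1n.
have t_le : (Num.truncn (n%:R * tnth y i) <= n)%N.
  by apply: leq_trans le_n; rewrite (bigD1 i)//= leq_addr.
have : n%:R * tnth y i < n%:R * 2.
  apply: lt_le_trans (truncnS_gt _) _; rewrite -natr1.
  by move: t_le; rewrite -(ler_nat R); lra.
by rewrite ltr_pM2l// ltr0n.
Qed.

(** The constant area element of the hyperplane occurs on both sides of
    [uniform_law_mass] and cancels. *)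
Lemma uniform_ordered_simplex_mass U : measurable U ->
  (leb D * uniform_ordered_simplex R d.+1 U = leb (D `&` hp @^-1` U))%E.
Proof.
move=> mU; pose s := Num.sqrt (1 + \sum_(j < d) (-1 : R) ^+ 2).
have surfE V : hyperplane_surface R d.+1 V = (s%:E * leb (hp @^-1` V))%E by [].
have s_gt0 : 0 < s.
  rewrite sqrtr_gt0 ltr_pwDl//; apply: sumr_ge0 => j _.
  by rewrite sqrrN expr1n.
have Dlty : (leb D < +oo)%E.
  apply: le_lt_trans bounding_cube_lty; apply: le_measure; rewrite ?inE.
  - exact: measurable_simplex_chart.
  - exact: measurable_bounding_cube.
  - exact: simplex_chart_sub.
have := @uniform_law_mass _ _ R (hyperplane_surface R d.+1) _
  (@ordered_simplex_measurable R d.+1) U mU.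
rewrite !surfE => /(_ _); rewrite -/D lte_mul_pinfty// ?lee_fin ?ltW//.
move=> /(_ isT); rewrite -muleA => h.
have sK x : (s^-1%:E * (s%:E * x) = x)%E.
  by rewrite muleA -EFinM mulVf ?mul1e// gt_eqF.
by rewrite -[LHS]sK h sK.
Qed.

Definition rescaled_floor n y : borel 'rV[R]_d.+1 :=
  rescale R n (floor_partition n y).

Lemma rescaled_partition_law_mass n (A : set (d.+1.-tuple nat)) U :
  (0 < n)%N -> (forall k, A k -> sumn k = n) -> measurable U ->
  (leb (floor_cell n A) * rescaled_partition_law R n A U =
   leb (floor_cell n A `&` rescaled_floor n @^-1` U))%E.
Proof.
move=> n0 An mU; pose V := rescale R n @^-1` U.
have -> : floor_cell n A `&` rescaled_floor n @^-1` U = floor_cell n (A `&` V).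
  by apply/seteqP; split=> y; [move=> [[? ?] ?]|move=> [? [? ?]]]; do ?split.
rewrite !lebesgue_floor_cell//; last by move=> k [/An].
rewrite -muleA -(uniform_law_mass (measurable_tuple_nat A)
  (measurable_tuple_nat V)).
  by [].
by rewrite /= /counting asboolT ?ltry//; exact: finite_sumn_eq An.
Qed.

Lemma near_lt_mulrSn (c e : R) : 0 < e -> \forall n \near \oo, c < n.+1%:R * e.
Proof.
move=> e0; near=> n; rewrite -ltr_pdivrMr//.
apply: (@lt_trans _ _ n%:R); last by rewrite ltr_nat.
by near: n; exact: nbhs_infty_gtr.
Unshelve. all: by end_near. Qed.

Section admissible.
Variable A : nat -> set (d.+1.-tuple nat).
Hypothesis exactly_A : forall n, partitions_exactly d.+1 n `<=` A n.
Hypothesis A_at_most : forall n, A n `<=` partitions_at_most d.+1 n.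

Let A_sum n k : A n k -> sumn k = n.
Proof. by move=> /A_at_most[]. Qed.

(** In the chart, all gaps between coordinates and the last coordinate are
    positive, and they survive the rounding error as soon as [n] times their
    size exceeds it.  Outside the chart some coordinate is negative or some pair
    is in the wrong strict order, and the same estimate shows that the rounded
    point cannot be a partition. *)
Lemma near_floor_cell_chart y :
  (forall i j, (i < j)%N -> co y ord0 i != co y ord0 j) ->
  co y ord0 ord_max != 0 ->
  \forall n \near \oo, floor_cell n.+1 (A n.+1) y <-> D y.
Proof.
move=> yneq ymax; have [Dy|nDy] := pselect (D y).
  have [y01 ydec ysum] := Dy.
  have ymax_gt0 : 0 < co y ord0 ord_max.
    by rewrite lt_neqAle eq_sym ymax; have /andP[] := y01 ord_max.
  have y0 (l : 'I_d) : 0 <= tnth y l.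
    by have /andP[] := y01 (widen_ord (leqnSn d) l); rewrite hyperplane_point_widen.
  have near_gap : \forall n \near \oo, forall i j, (i < j)%N ->
      2 * K < n.+1%:R * (co y ord0 i - co y ord0 j).
    apply: filter_forall => i; apply: filter_forall => j.
    have [ij|ij] := ltnP i j; last by near=> n.
    have e0 : 0 < co y ord0 i - co y ord0 j by rewrite subr_gt0 ydec.
    by have := near_lt_mulrSn (2 * K) e0; apply: filterS => n.
  have near_max := near_lt_mulrSn K ymax_gt0.
  near=> n; split=> // _; split=> //; apply: exactly_A.
  have sumE : sumn (floor_partition n.+1 y) = n.+1.
    apply/eqP; rewrite sumn_floor_partition -(ler_nat R) natr_sum.
    apply: (@le_trans _ _ (\sum_(j < d) n.+1%:R * tnth y j)).
      by apply: ler_sum => j _; rewrite truncn_le mulr_ge0.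
    rewrite -mulr_sumr ler_piMr//.
    by move: ymax_gt0; rewrite hyperplane_point_max subr_gt0 => /ltW.
  have close := floor_partition_close y0 sumE.
  have gap : forall i j, (i < j)%N ->
      2 * K < n.+1%:R * (co y ord0 i - co y ord0 j) by near: n.
  have max_gt : K < n.+1%:R * co y ord0 ord_max.
    by near: n.
  have sk : sorted geq (floor_partition n.+1 y).
    apply: sorted_geq_tuple => i j ij.
    exact: (floor_partition_lt close (gap i j ij)).
  split; first by split.
  apply/all_tnthP => i; apply: leq_trans (floor_partition_gt0 close max_gt) _.
  by apply: tnth_sorted_geq => //; rewrite -ltnS.
have : (exists i, co y ord0 i < 0) \/
    (exists ij : 'I_d.+1 * 'I_d.+1, (ij.1 < ij.2)%N /\
      co y ord0 ij.1 < co y ord0 ij.2).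
  apply: contrapT => /not_orP[yneg yinc]; apply: nDy; apply: simplex_chartP.
    by move=> i; rewrite leNgt; apply/negP => yi; apply: yneg; exists i.
  move=> i j ij; rewrite lt_neqAle eq_sym yneq//= leNgt; apply/negP => yij.
  by apply: yinc; exists (i, j).
move=> [[i yi]|[[i j] /= [ij yij]]].
  have e0 : 0 < - co y ord0 i by rewrite oppr_gt0.
  have := near_lt_mulrSn K e0; apply: filterS => n h; split=> // -[y0 Ay].
  have := floor_partition_close y0 (A_sum Ay) i.
  rewrite ler_norml => /andP[_]; rewrite mulrN in h.
  have := ler0n R (tnth (floor_partition n.+1 y) i); lra.
have e0 : 0 < co y ord0 j - co y ord0 i by rewrite subr_gt0.
have := near_lt_mulrSn (2 * K) e0; apply: filterS => n h; split=> // -[y0 Ay].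
have := floor_partition_lt (floor_partition_close y0 (A_sum Ay)) h.
have [sk _] := A_at_most Ay.
by rewrite ltnNge tnth_sorted_geq// ltnW.
Unshelve. all: by end_near. Qed.

Lemma cvg_rescaled_floor y :
  (\forall n \near \oo, floor_cell n.+1 (A n.+1) y) ->
  (rescaled_floor n.+1 y : 'rV[R]_d.+1) @[n --> \oo] --> co y.
Proof.
move=> Ey; apply/cvg_ballP => e e0.
have near_e := near_lt_mulrSn K e0; near=> n.
have [y0 Ay] : floor_cell n.+1 (A n.+1) y by near: n.
split=> // i j; rewrite (ord1 i) /rescaled_floor /ball/= distrC [X in X - _]mxE.
have n0 : 0 < n.+1%:R :> R by rewrite ltr0n.
rewrite -[X in _ - X](mulKf (lt0r_neq0 n0)) [X in _ - X]mulrC -mulrBl normrM.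
rewrite [X in _ * X]gtr0_norm ?invr_gt0// ltr_pdivrMr// [ltRHS]mulrC.
apply: le_lt_trans (floor_partition_close y0 (A_sum Ay) j) _.
by near: n.
Unshelve. all: by end_near. Qed.

Lemma weak_cvg_rescaled_partition :
  weak_cvg (fun n => rescaled_partition_law R n (A n))
    (uniform_ordered_simplex R d.+1).
Proof.
(* For [n = 0] the cell of the zero partition is unbounded and escapes the
   bounding cube. *)
suff shifted : weak_cvg (fun n => rescaled_partition_law R n.+1 (A n.+1))
    (uniform_ordered_simplex R d.+1).
  by move=> f cf bf; rewrite -cvg_shiftS; exact: shifted.
apply: (@weak_cvg_image_of_uniform _ _ _ _ leb bounding_cube D
  (fun n => floor_cell n.+1 (A n.+1)) hp (fun n => rescaled_floor n.+1)).
- exact: measurable_bounding_cube.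
- exact: measurable_simplex_chart.
- by move=> n; exact: measurable_floor_cell.
- exact: hyperplane_point_measurable.
- move=> n; apply: (measurableT_comp (f := rescale R n.+1)) => //.
  exact: measurable_floor_partition.
- exact: bounding_cube_lty.
- exact: simplex_chart_sub.
- by move=> n; apply: floor_cell_sub => // k; exact: A_sum.
- apply: filterS (hyperplane_point_generic R d_gt0) => y [yneq ymax].
  have E_D := near_floor_cell_chart yneq ymax; split=> // Dy.
  by apply: cvg_rescaled_floor; apply: filterS E_D => n [_]; exact.
- exact: simplex_chart_gt0.
- by move=> n U mU; apply: rescaled_partition_law_mass => // k; exact: A_sum.
- by move=> U mU; exact: uniform_ordered_simplex_mass.
Qed.
End admissible.
End limit.

Theorem theorem6 (R : realType) (m : nat) (hm : (2 <= m)%N) :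
  weak_cvg (fun n : nat => rescaled_partition_law R n (partitions_at_most m n))
    (uniform_ordered_simplex R m) /\
  weak_cvg (fun n : nat => rescaled_partition_law R n (partitions_exactly m n))
    (uniform_ordered_simplex R m).
Proof.
case: m hm => [//|d] d_gt0.
by split; apply: weak_cvg_rescaled_partition => // n k [].
Qed.
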